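(* Let $\mathcal E\colon L^2(\mu)\to[0,\infty]$ be a lower semicontinuous convex functional with $\mathcal E(-f)=\mathcal E(f)$ for all $f$ and $\mathcal E(0)=0$. Assume one of the following two conditions: (A) $(M(\mathcal E),\|\cdot\|_L)$ is a Banach space; (B) $\mathcal E$ is a nonlinear Dirichlet form. Then the extended functional $\mathcal E_e$ exists, i.e. $\mathcal E$ (extended by $+\infty$ to $L^0(\mu)\setminus L^2(\mu)$) is lower semicontinuous on $D(\mathcal E)$ with respect to local convergence in measure. If (A) holds, then $\mathcal E=\mathcal E_e$, where $\mathcal E$ is regarded as a functional on $L^0(\mu)$ by setting it equal to $+\infty$ outside $L^2(\mu)$.
   Context: Let $(X,\mathfrak A,\mu)$ be a $\sigma$-finite measure space; $L^2(\mu)$ is the Hilbert space of real square integrable functions and $L^0(\mu)$ the space of (classes of) real measurable functions with the topology of local convergence in measure ($f_n\to f$ iff every subsequence has a further subsequence converging $\mu$-a.e. to $f$). $D(\mathcal E)=\{f:\mathcal E(f)<\infty\}$. The modular space is $M(\mathcal E)=\{f\in L^2(\mu): \lim_{\lambda\to0+}\mathcal E(\lambda f)=0\}$ (the linear hull of $D(\mathcal E)$), with Luxemburg seminorm $\|f\|_L=\inf\{\lambda>0:\mathcal E(\lambda^{-1}f)\le 1\}$. A normal contraction is a 1-Lipschitz $C\colon\mathbb R\to\mathbb R$ with $C(0)=0$; it operates on $\mathcal E$ if $\mathcal E(f+Cg)+\mathcal E(f-Cg)\le\mathcal E(f+g)+\mathcal E(f-g)$ for all $f,g$. A nonlinear Dirichlet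 form is a proper lower semicontinuous convex functional $\mathcal E\colon L^2(\mu)\to[0,\infty]$ (here symmetric with $\mathcal E(0)=0$) on which every normal contraction operates. If $\mathcal E$, extended by $+\infty$ to $L^0(\mu)$, satisfies $\mathcal E(f)\le\liminf\mathcal E(f_n)$ whenever $f_n,f\in D(\mathcal E)$ and $f_n\to f$ locally in measure, then its lower semicontinuous relaxation on $L^0(\mu)$ (the largest minorant that is lower semicontinuous for local convergence in measure) extends $\mathcal E$ and is denoted $\mathcal E_e$; in this case one says $\mathcal E_e$ exists. *)

(* Defs.v *)
From HB Require Import structures.
From mathcomp Require Import all_boot all_order all_algebra.
From mathcomp Require Import all_classical all_reals all_analysis.
Set Implicit Arguments. Unset Strict Implicit. Unset Printing Implicit Defensive.
Import Order.TTheory GRing.Theory Num.Theory.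
Import numFieldNormedType.Exports.
Local Open Scope classical_set_scope.
Local Open Scope ring_scope.

Section Defs.
Context {d : measure_display} {T : measurableType d} {R : realType}.
Variable mu : {measure set T -> \bar R}.

(* Representatives of elements of L^0(mu): measurable real functions. *)
Definition L0 (f : T -> R) : Prop := measurable_fun setT f.

(* Representatives of elements of L^2(mu). *)
Definition L2 (f : T -> R) : Prop :=
  measurable_fun setT f /\ (\int[mu]_x ((f x) ^+ 2)%:E < +oo)%E.

Definition loc_cvg_in_measure (u : nat -> T -> R) (f : T -> R) : Prop :=
  forall phi : nat -> nat, {homo phi : n m / (n < m)%N} ->
  exists psi : nat -> nat, {homo psi : n m / (n < m)%N} /\
    {ae mu, forall x, (fun k => u (phi (psi k)) x) @ \oo --> f x}.

Definition L2_cvg (u : nat -> T -> R) (f : T -> R) : Prop :=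
  (fun n => (\int[mu]_x (((u n x - f x) ^+ 2)%:E))%E) @ \oo --> 0%E.

Variable E : (T -> R) -> \bar R.

(* E is a well-defined functional on L^2(mu) (classes), [0,oo]-valued *)
Definition respects_ae : Prop :=
  forall f g, L2 f -> L2 g -> {ae mu, forall x, f x = g x} -> E f = E g.

Definition nonneg_fun : Prop := forall f, L2 f -> (0 <= E f)%E.

Definition lsc_L2 : Prop :=
  forall (u : nat -> T -> R) f, (forall n, L2 (u n)) -> L2 f ->
    L2_cvg u f -> (E f <= limn_einf (fun n => E (u n)))%E.

Definition convex_fun : Prop :=
  forall f g (t : R), L2 f -> L2 g -> 0 < t < 1 ->
    (E (fun x => (t * f x + (1 - t) * g x)%R) <=
       t%:E * E f + (1 - t)%R%:E * E g)%E.

Definition symmetric_fun : Prop := forall f, L2 f -> E (fun x => - f x) = E f.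

Definition domE (f : T -> R) : Prop := L2 f /\ (E f < +oo)%E.

Definition modular (f : T -> R) : Prop :=
  L2 f /\ (E (fun x => l * f x)) @[l --> 0^'+] --> 0%E.

Definition lux (f : T -> R) : \bar R :=
  ereal_inf [set l%:E | l in [set l : R | 0 < l /\ (E (fun x => (l^-1 * f x)%R) <= 1)%E]].

(* (M(E), ||.||_L) is a Banach space: ||.||_L is a norm on M(E)
   (as a space of mu-classes) and M(E) is complete for it. *)
Definition modular_banach : Prop :=
  (forall f, modular f -> lux f = 0%E -> {ae mu, forall x, f x = 0}) /\
  (forall u : nat -> T -> R, (forall n, modular (u n)) ->
     (forall e : R, 0 < e -> exists N, forall n m, (N <= n)%N -> (N <= m)%N ->
        (lux (fun x => (u n x - u m x)%R) <= e%:E)%E) ->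
     exists f, modular f /\
       (forall e : R, 0 < e -> exists N, forall n, (N <= n)%N ->
          (lux (fun x => (u n x - f x)%R) <= e%:E)%E)).

Definition normal_contraction (C : R -> R) : Prop :=
  C 0 = 0 /\ forall a b, `|C a - C b| <= `|a - b|.

Definition operates (C : R -> R) : Prop :=
  forall f g, L2 f -> L2 g ->
    (E (fun x => (f x + C (g x))%R) + E (fun x => (f x - C (g x))%R) <=
     E (fun x => (f x + g x)%R) + E (fun x => (f x - g x)%R))%E.

(* nonlinear Dirichlet form (proper lsc convex is assumed separately) *)
Definition dirichlet_form : Prop :=
  forall C, normal_contraction C -> operates C.

Definition Eext (f : T -> R) : \bar R := if `[< L2 f >] then E f else +oo%E.

End Defs.

Section Relax.
Context {d : measure_display} {T : measurableType d} {R : realType}.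
Variable mu : {measure set T -> \bar R}.

Definition lsc_L0 (G : (T -> R) -> \bar R) : Prop :=
  forall (u : nat -> T -> R) f, (forall n, L0 (u n)) -> L0 f ->
    loc_cvg_in_measure mu u f -> (G f <= limn_einf (fun n => G (u n)))%E.

Definition relaxation (G : (T -> R) -> \bar R) (f : T -> R) : \bar R :=
  ereal_sup [set H f | H in [set H : (T -> R) -> \bar R |
     lsc_L0 H /\ forall g, L0 g -> (H g <= G g)%E]].

Definition Ee_exists (E : (T -> R) -> \bar R) : Prop :=
  forall (u : nat -> T -> R) f, (forall n, domE mu E (u n)) -> domE mu E f ->
    loc_cvg_in_measure mu u f -> (E f <= limn_einf (fun n => E (u n)))%E.
End Relax.

(* Main.v *)
(** By passing to subsequences, lower semicontinuity in measure reduces to: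
    if [u n] converges a.e. to [f] and [E (u n) <= c], then [E f <= c].

    (A) A gliding-hump argument in the complete space M(E) shows that sublevel
    sets of [E] are bounded in L^2.  Near-minimisers of the L^2 norm among the
    functions of energy at most [c] lying pointwise in the convex hull of
    [u k], [k >= n], then form an L^2-Cauchy sequence converging a.e. to [f],
    so [f] is in L^2 and L^2 lower semicontinuity applies.

    (B) Composing with bounded contractions that vanish near 0 reduces to [u]
    uniformly bounded and [f] integrable.  The minimiser [w] of
    [E + lam * ||. - f||^2] is then integrable as well, because shrinking [w]
    by a small truncation cannot decrease the objective.  Hence dominated
    convergence applies in the subgradient inequality
    [E w <= E (u n) + 2 lam <w - f, u n - w>] and gives
    [E w <= c - 2 lam ||w - f||^2 <= c]; finally let [lam] tend to infinity. *)
Require Import Defs.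
From HB Require Import structures.
From mathcomp Require Import all_boot all_order all_algebra.
From mathcomp Require Import all_classical all_reals all_analysis.
From mathcomp Require Import measurable_realfun ring lra.
Import Order.TTheory GRing.Theory Num.Theory.
Set Implicit Arguments. Unset Strict Implicit. Unset Printing Implicit Defensive.
Import numFieldNormedType.Exports.
Local Open Scope classical_set_scope.
Local Open Scope ring_scope.

(** * Algebra of square integrable functions *)

Section SquareIntegrable.
Context {d : measure_display} {T : measurableType d} {R : realType}
  (mu : {measure set T -> \bar R}).
Implicit Types f g h : T -> R.

Definition integ f := mu.-integrable setT (fun x => (f x)%:E).
Definition ip f g : R := Rintegral mu setT (fun x => f x * g x).
(** The squared L^2 norm. [Rintegral] sends an infinite integral to 0, so the value is meaningful
    only together with [L2 mu f]. *)
Definition nsq f : R := Rintegral mu setT (fun x => f x ^+ 2).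

Lemma integ_meas f : integ f -> measurable_fun setT f.
Proof. by move=> /measurable_int /measurable_EFinP. Qed.

Lemma integ_le f g : measurable_fun setT f -> (forall x, `|f x| <= g x) ->
  integ g -> integ f.
Proof.
move=> mf fg; apply: le_integrable => //; first exact/measurable_EFinP.
by move=> x _; rewrite !abse_EFin lee_fin (le_trans (fg x))// ler_norm.
Qed.

Lemma integD f g : integ f -> integ g -> integ (fun x => f x + g x).
Proof. by move=> If Ig; have := integrableD measurableT If Ig. Qed.

Lemma integZ (a : R) f : integ f -> integ (fun x => a * f x).
Proof. by move=> If; have := integrableZl measurableT a If. Qed.

Lemma integN f : integ f -> integ (fun x => `|f x|).
Proof. exact: integrable_norm. Qed.

Lemma L2P f : L2 mu f <-> measurable_fun setT f /\ integ (fun x => f x ^+ 2).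
Proof.
split=> -[mf If]; split=> //.
  apply/integrableP; split.
    by apply/measurable_EFinP; apply: measurable_funX.
  by under eq_integral do rewrite gee0_abs ?lee_fin ?sqr_ge0//.
by apply: integrable_lty.
Qed.

Lemma L2_meas f : L2 mu f -> measurable_fun setT f.
Proof. by case. Qed.

Lemma L2_sqr f : L2 mu f -> integ (fun x => f x ^+ 2).
Proof. by move=> /L2P[]. Qed.

Lemma L2_mul f g : L2 mu f -> L2 mu g -> integ (fun x => f x * g x).
Proof.
move=> Lf Lg; apply: (@integ_le _ (fun x => f x ^+ 2 + g x ^+ 2)).
- by apply: measurable_funM; exact: L2_meas.
- move=> x; rewrite normrM; have := sqr_ge0 (`|f x| - `|g x|).
  rewrite sqrrB !real_normK ?num_real// => h.
  by have := sqr_ge0 (f x); have := sqr_ge0 (g x); lra.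
- by apply: integD; exact: L2_sqr.
Qed.

Lemma L2_le f g : measurable_fun setT f -> (forall x, `|f x| <= `|g x|) ->
  L2 mu g -> L2 mu f.
Proof.
move=> mf fg Lg; apply/L2P; split=> //.
apply: (@integ_le _ (fun x => g x ^+ 2)).
- exact: measurable_funX.
- by move=> x; rewrite normrX -[leRHS]real_normK ?num_real// lerXn2r ?nnegrE//.
- exact: L2_sqr.
Qed.

Lemma L2_lin (a b : R) f g : L2 mu f -> L2 mu g ->
  L2 mu (fun x => a * f x + b * g x).
Proof.
move=> Lf Lg; apply/L2P; split.
  by apply: measurable_funD; apply: measurable_funM => //; exact: L2_meas.
have -> : (fun x => (a * f x + b * g x) ^+ 2) =
  (fun x => a ^+ 2 * f x ^+ 2 + ((a * b *+ 2) * (f x * g x) + b ^+ 2 * g x ^+ 2)).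
  by apply/funext => x; ring.
apply: integD; first by apply: integZ; exact: L2_sqr.
apply: integD; first by apply: integZ; exact: L2_mul.
by apply: integZ; exact: L2_sqr.
Qed.

Lemma L2_0 : L2 mu (fun _ => 0 : R).
Proof.
split; first exact: measurable_cst.
by under eq_integral do rewrite expr0n /=; rewrite integral0.
Qed.

Lemma L2Z (a : R) f : L2 mu f -> L2 mu (fun x => a * f x).
Proof.
move=> Lf; have := L2_lin a 0 Lf Lf.
by congr L2; apply/funext => x; ring.
Qed.

Lemma L2D f g : L2 mu f -> L2 mu g -> L2 mu (fun x => f x + g x).
Proof.
move=> Lf Lg; have := L2_lin 1 1 Lf Lg.
by congr L2; apply/funext => x; ring.
Qed.

Lemma L2B f g : L2 mu f -> L2 mu g -> L2 mu (fun x => f x - g x).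
Proof.
move=> Lf Lg; have := L2_lin 1 (-1) Lf Lg.
by congr L2; apply/funext => x; ring.
Qed.

Lemma L2N f : L2 mu f -> L2 mu (fun x => - f x).
Proof.
move=> Lf; have := L2Z (-1) Lf.
by congr L2; apply/funext => x; ring.
Qed.

Lemma nsq_ge0 f : 0 <= nsq f.
Proof. by apply: Rintegral_ge0 => x _; exact: sqr_ge0. Qed.

Lemma nsqE f : L2 mu f -> (\int[mu]_x (f x ^+ 2)%:E)%E = (nsq f)%:E.
Proof.
move=> Lf; rewrite /nsq /Rintegral fineK//.
exact: integrable_fin_num (L2_sqr Lf).
Qed.

Lemma nsq_lin (a b : R) f g : L2 mu f -> L2 mu g ->
  nsq (fun x => a * f x + b * g x) =
  a ^+ 2 * nsq f + ((a * b *+ 2) * ip f g + b ^+ 2 * nsq g).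
Proof.
move=> Lf Lg.
have I1 := L2_sqr Lf; have I2 := L2_sqr Lg; have I3 := L2_mul Lf Lg.
rewrite /nsq /ip.
have -> : (fun x => (a * f x + b * g x) ^+ 2) =
  (fun x => a ^+ 2 * f x ^+ 2 + ((a * b *+ 2) * (f x * g x) + b ^+ 2 * g x ^+ 2)).
  by apply/funext => x; ring.
rewrite RintegralD//; last 2 first.
- exact: integZ.
- by apply: integD; exact: integZ.
rewrite RintegralD//; [|exact: integZ..].
by rewrite !RintegralZl.
Qed.

Lemma nsqZ (a : R) f : L2 mu f -> nsq (fun x => a * f x) = a ^+ 2 * nsq f.
Proof.
move=> Lf; have := nsq_lin a 0 Lf Lf.
rewrite (_ : (fun x => a * f x + 0 * f x) = (fun x => a * f x)).
  by move=> ->; ring.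
by apply/funext => x; ring.
Qed.

(** The parallelogram law; its last term is the strong convexity of the squared norm that
    [near_minimizers_cauchy] asks for. *)
Lemma nsq_mid f g : L2 mu f -> L2 mu g ->
  nsq (fun x => 2^-1 * f x + 2^-1 * g x) =
  2^-1 * nsq f + 2^-1 * nsq g - 4^-1 * nsq (fun x => f x - g x).
Proof.
move=> Lf Lg; rewrite nsq_lin//.
have -> : (fun x => f x - g x) = (fun x => 1 * f x + (-1) * g x).
  by apply/funext => x; ring.
by rewrite nsq_lin//; field.
Qed.

(** The parallelogram law with the square of the difference dropped. It plays the role of the
    triangle inequality for squared norms. *)
Lemma nsqD_le f g : L2 mu f -> L2 mu g ->
  nsq (fun x => f x + g x) <= 2 * nsq f + 2 * nsq g.
Proof.
move=> Lf Lg.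
have e1 : nsq (fun x => f x + g x) = nsq (fun x => 1 * f x + 1 * g x).
  by congr nsq; apply/funext => x; ring.
have := nsq_ge0 (fun x => 1 * f x + (-1) * g x).
by rewrite e1 !nsq_lin//; nra.
Qed.

Lemma nsq_sym f g : nsq (fun x => f x - g x) = nsq (fun x => g x - f x).
Proof. by congr Rintegral; apply/funext => x; ring. Qed.

Lemma ae_eq_nsq f g : L2 mu f -> L2 mu g -> {ae mu, forall x, f x = g x} ->
  nsq f = nsq g.
Proof.
move=> Lf Lg fg; rewrite /nsq /Rintegral; congr fine.
apply: ae_eq_integral => //.
- by apply: measurable_int (L2_sqr Lf).
- by apply: measurable_int (L2_sqr Lg).
- by apply: filterS fg => x -> _.
Qed.

End SquareIntegrable.

(** * Lower limits of sequences of extended reals *)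

Section LowerLimits.
Context {R : realType}.
Implicit Types (v : nat -> \bar R) (a : \bar R).
Local Open Scope ereal_scope.

Lemma limn_einfE v : limn_einf v = ereal_sup (range (einfs v)).
Proof. by rewrite limn_einf_lim; apply/cvg_lim => //; exact: cvg_einfs_sup. Qed.

Lemma limn_einf_le v a N : (forall n, (N <= n)%N -> v n <= a) ->
  limn_einf v <= a.
Proof.
move=> va; rewrite limn_einfE; apply: ge_ereal_sup => _ [n _ <-].
apply: (@le_trans _ _ (v (maxn n N))); last by apply: va; rewrite leq_maxr.
by apply: ereal_inf_lbound; exists (maxn n N) => //=; rewrite leq_maxl.
Qed.

Lemma lte_real_between (a b : \bar R) : a < b -> exists c : R, a < c%:E < b.
Proof.
move: a b => [x| |] [y| |]//; rewrite ?lte_fin => xy.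
- by exists ((x + y) / 2)%R; rewrite !lte_fin; apply/andP; split; lra.
- by exists (x + 1)%R; rewrite lte_fin ltry andbT; lra.
- by exists (y - 1)%R; rewrite lte_fin ltNyr /=; lra.
- by exists 0%R; rewrite ltry ltNyr.
Qed.

(** If the lower limit were below [a], a real [c] strictly between them would exceed [v] at
    infinitely many indices, and these form the subsequence [phi]. Lower semicontinuity thus becomes
    a statement about sublevel sets. *)
Lemma le_limn_einf v a :
  (forall (c : R) (phi : nat -> nat), {homo phi : n m / (n < m)%N} ->
     (forall n, v (phi n) <= c%:E) -> a <= c%:E) ->
  a <= limn_einf v.
Proof.
move=> H; rewrite leNgt; apply/negP => /lte_real_between[c /andP[vc ca]].
have /choice[h hP] : forall n, exists k, (n <= k)%N /\ v k < c%:E.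
  move=> n; have : einfs v n < c%:E.
    apply: le_lt_trans vc; rewrite limn_einfE; apply: ereal_sup_ubound.
    by exists n.
  by move=> /ereal_inf_lt[_ [k /= nk <-] vk]; exists k.
pose phi := fix phi n := if n is m.+1 then h (phi m).+1 else h 0%N.
suff : a <= c%:E by rewrite leNgt ca.
apply: (H c phi).
  by apply: homo_ltn => [? ? ?|n]; [exact: ltn_trans|exact: (hP _).1].
by move=> [|n] /=; apply: ltW; exact: (hP _).2.
Qed.

End LowerLimits.

(** * Fatou's lemma, completeness of L^2 and lower semicontinuity of the norm *)

Section SquareIntegrableLimits.
Context {d : measure_display} {T : measurableType d} {R : realType}
  (mu : {measure set T -> \bar R}).
Implicit Types (f g h : T -> R) (u : nat -> T -> R).
Local Notation nsq := (nsq mu).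

Definition ae_cvg u f := {ae mu, forall x, (fun n => u n x) @ \oo --> f x}.

Definition nsq_cvg u f := forall e : R, 0 < e ->
  exists N, forall n, (N <= n)%N -> nsq (fun x => u n x - f x) <= e.

Definition nsq_cauchy u := forall e : R, 0 < e -> exists N, forall n m,
  (N <= n)%N -> (N <= m)%N -> nsq (fun x => u n x - u m x) <= e.

Lemma nsq_cvgP u f : (forall n, L2 mu (u n)) -> L2 mu f ->
  nsq_cvg u f <-> L2_cvg mu u f.
Proof.
move=> Lu Lf; rewrite /L2_cvg.
rewrite (_ : (fun n => _) = (fun n => (nsq (fun x => u n x - f x))%:E)); last first.
  by apply/funext => n; rewrite nsqE//; exact: L2B.
split=> [H|].
  apply: cvg_EFin; first exact: nearW.
  apply/cvgrPdist_le => e e0; have [N HN] := H _ e0.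
  exists N => // n /= Nn; rewrite sub0r normrN ger0_norm ?nsq_ge0//.
  exact: HN.
move=> /fine_cvgP[_ /cvgrPdist_le H] e e0.
have [N _ HN] := H _ e0; exists N => n Nn.
by have := HN n Nn; rewrite /= sub0r normrN ger0_norm ?nsq_ge0.
Qed.

Lemma fatou_nsq u f (C : R) : (forall n, L2 mu (u n)) -> measurable_fun setT f ->
  (forall n, nsq (u n) <= C) -> ae_cvg u f -> L2 mu f /\ nsq f <= C.
Proof.
move=> Lu mf uC uf.
have mu2 n : measurable_fun setT (fun x => (u n x ^+ 2)%:E).
  exact: measurable_int (L2_sqr (Lu n)).
have H : (\int[mu]_x ((f x) ^+ 2)%:E <= C%:E)%E.
  have -> : (\int[mu]_x ((f x) ^+ 2)%:E =
    \int[mu]_x limn_einf (fun n => (u n x ^+ 2)%:E))%E.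
    apply: ae_eq_integral => //.
    - by apply/measurable_EFinP; exact: measurable_funX.
    (* A lower limit is minus the upper limit of the opposites, whose measurability is available. *)
    - apply: (@measurableT_comp _ _ _ _ _ _ -%E) => //.
      apply: (@measurable_fun_limn_esup _ _ _ _
        (fun n x => - (u n x ^+ 2)%:E)%E) => n.
      exact: (@measurableT_comp _ _ _ _ _ _ -%E).
    apply: filterS uf => x ux _; apply/esym.
    apply: (@cvg_limn_einf_sup _ _ _ _).1.
    apply: cvg_EFin; first exact: nearW.
    by rewrite expr2; under eq_fun do rewrite /= expr2; apply: cvgM.
  apply: (le_trans (fatou mu measurableT mu2 _)).
    by move=> n x _; rewrite lee_fin sqr_ge0.
  apply: (@limn_einf_le _ _ _ 0%N) => n _.
  by rewrite nsqE// lee_fin.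
have Lf : L2 mu f by split=> //; apply: le_lt_trans H (ltry _).
by split=> //; rewrite -lee_fin -nsqE.
Qed.

(** Fatou's lemma applied to [u n - u (m + N)] as m grows, with n fixed, transfers the Cauchy bound
    to [u n - f]; then f = u N - (u N - f) is in L^2. *)
Lemma nsq_cauchy_ae_cvg u f : (forall n, L2 mu (u n)) -> measurable_fun setT f ->
  nsq_cauchy u -> ae_cvg u f -> L2 mu f /\ nsq_cvg u f.
Proof.
move=> Lu mf uc uf.
have H (e : R) N : (forall n m, (N <= n)%N -> (N <= m)%N ->
    nsq (fun x => u n x - u m x) <= e) -> forall n, (N <= n)%N ->
    L2 mu (fun x => u n x - f x) /\ nsq (fun x => u n x - f x) <= e.
  move=> HN n Nn; apply: (@fatou_nsq (fun m x => u n x - u (m + N)%N x)).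
  - by move=> m; exact: L2B.
  - by apply: measurable_funB => //; exact: L2_meas (Lu n).
  - by move=> m; apply: HN => //; rewrite leq_addl.
  - apply: filterS uf => x ux; apply: cvgB; first exact: cvg_cst.
    by rewrite (@cvg_shiftn N _ (fun n => u n x)).
split; last first.
  by move=> e /uc[N HN]; exists N => n Nn; exact: (H _ _ HN n Nn).2.
have [N HN] := uc 1 ltr01.
have [Ld _] := H _ _ HN N (leqnn N).
have := L2B (Lu N) Ld.
by congr L2; apply/funext => x; ring.
Qed.

(** The series of the 4^n (u n.+1 - u n)^2 has integral at most the sum of the 2^-(n+1), that is 1,
    so it is finite almost everywhere. There the increments are O(2^-n) and the telescoping series
    converges absolutely. *)
Lemma nsq_fast_ae_cvg u : (forall n, L2 mu (u n)) ->
  (forall n, 4 ^+ n * nsq (fun x => u n.+1 x - u n x) <= (2 ^ n.+1)%:R^-1) ->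
  exists f, measurable_fun setT f /\ ae_cvg u f.
Proof.
move=> Lu ufast.
pose D n x := u n.+1 x - u n x.
have LD n : L2 mu (D n) by exact: L2B.
pose F n x := (4 ^+ n * D n x ^+ 2)%:E.
have F0 n x : (0 <= F n x)%E by rewrite lee_fin mulr_ge0 ?sqr_ge0 ?exprn_ge0//.
have IF n : mu.-integrable setT (F n) by exact: integZ (L2_sqr (LD n)).
have mF n : measurable_fun setT (F n) by exact: measurable_int (IF n).
pose S x := (\sum_(n <oo) F n x)%E.
have mS : measurable_fun setT S by exact: ge0_emeasurable_sum.
have S0 x : (0 <= S x)%E by exact: nneseries_ge0.
have IS : mu.-integrable setT S.
  apply/integrableP; split=> //.
  under eq_integral do rewrite gee0_abs//.
  rewrite integral_nneseries//.
  apply: (@le_lt_trans _ _ 1%:E); last exact: ltry.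
  apply: le_trans (epsilon_trick0 xpredT ler01).
  apply: lee_nneseries => [n _ _|n _]; first exact: integral_ge0.
  rewrite /F; under eq_integral do rewrite EFinM.
  have mD2 := measurable_int mu (L2_sqr (LD n)).
  rewrite (ge0_integralZl mu measurableT mD2); last 2 first.
  - by move=> x _; rewrite lee_fin sqr_ge0.
  - by rewrite lee_fin exprn_ge0.
  by rewrite nsqE// div1r -EFinM lee_fin; exact: ufast.
(* The upper limit is measurable, and it equals the limit wherever the sequence converges. *)
exists (fun x => fine (limn_esup (fun n => (u n x)%:E))); split.
  apply: (@measurableT_comp _ _ _ _ _ _ fine).
    exact: fine_measurable.
  apply: measurable_fun_limn_esup => n.
  by apply/measurable_EFinP; exact: L2_meas (Lu n).
apply: filterS (integrable_ae measurableT IS) => x /(_ I) Sfin.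
suff : cvgn (fun n => u n x).
  move=> /cvg_ex[l ul].
  rewrite (_ : limn_esup _ = l%:E)//.
  apply: (@cvg_limn_einf_sup _ _ _ _).2.
  by apply: cvg_EFin; first exact: nearW.
(* A single term is at most the whole sum S, so (2^n |D n x|)^2 <= S <= (S + 1)^2; the + 1 avoids a
   square root. *)
have bd n : `|D n x| <= geometric (fine (S x) + 1) (2^-1) n.
  have : (F n x <= S x)%E.
    apply: le_trans (nneseries_lim_ge n.+1 _) => //.
    by rewrite big_nat_recr//= leeDr// sume_ge0.
  rewrite -(fineK Sfin) lee_fin /= => h.
  have s0 : 0 <= fine (S x) by exact: fine_ge0.
  rewrite exprVn ler_pdivlMr ?exprn_gt0//.
  rewrite -(@ler_pXn2r _ 2)// ?nnegrE ?mulr_ge0 ?exprn_ge0 ?addr_ge0//.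
  rewrite exprMn -exprM mulnC exprM real_normK ?num_real// mulrC.
  by rewrite (_ : 2 ^+ 2 = 4)//; [apply: le_trans h _; nra|ring].
have cD : cvgn (series (fun n => D n x)).
  apply: normed_cvg.
  apply: (@series_le_cvg _ _ (geometric (fine (S x) + 1) (2^-1))).
  - by move=> n; exact: normr_ge0.
  - by move=> n; apply: le_trans (bd n); exact: normr_ge0.
  - exact: bd.
  - by apply: is_cvg_geometric_series; rewrite ger0_norm; lra.
have -> : (fun n => u n x) = (fun n => u 0%N x + series (fun n => D n x) n).
  by apply/funext => n; exact: (@eq_sum_telescope _ (fun n => u n x)).
by apply: is_cvgD => //; exact: is_cvg_cst.
Qed.

(** Riesz-Fischer: a subsequence with fast decreasing increments converges almost everywhere, and
    the Cauchy property makes its limit the L^2 limit of the whole sequence. *)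
Lemma nsq_complete u : (forall n, L2 mu (u n)) -> nsq_cauchy u ->
  exists f, L2 mu f /\ nsq_cvg u f.
Proof.
move=> Lu uc.
have /choice[N NP] : forall k : nat, exists N, forall n m,
    (N <= n)%N -> (N <= m)%N ->
    nsq (fun x => u n x - u m x) <= (4 ^+ k)^-1 * (2 ^ k.+1)%:R^-1.
  move=> k; apply: uc.
  by rewrite mulr_gt0 ?invr_gt0 ?exprn_gt0 ?ltr0n ?expn_gt0.
(* The sum over j gives N k <= phi k and N k <= phi k.+1, and the summand k gives k <= phi k. *)
pose phi k := (k + \sum_(j < k.+1) N j)%N.
have phiN k : (N k <= phi k)%N.
  by rewrite /phi big_ord_recr /= addnA leq_addl.
have phiS k : (N k <= phi k.+1)%N.
  rewrite /phi big_ord_recr /= big_ord_recr /= addnA.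
  by apply: leq_trans (leq_addr _ _); rewrite addnA leq_addl.
have phik k : (k <= phi k)%N by rewrite leq_addr.
have [] := @nsq_fast_ae_cvg (fun k => u (phi k)) => //.
  move=> n; rewrite mulrC -ler_pdivlMr ?exprn_gt0// mulrC.
  exact: NP.
move=> f [mf uf].
have vc : nsq_cauchy (fun k => u (phi k)).
  move=> e /uc[M MP]; exists M => n m Mn Mm.
  by apply: MP; [exact: leq_trans (phik n)|exact: leq_trans (phik m)].
have [Lf vf] := nsq_cauchy_ae_cvg (fun k => Lu (phi k)) mf vc uf.
exists f; split=> // e e0.
have e4 : 0 < e / 4 by lra.
have [M1 M1P] := uc _ e4; have [M2 M2P] := vf _ e4.
exists M1 => n Mn.
pose k := maxn M1 M2.
have -> : (fun x => u n x - f x) =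
    (fun x => (u n x - u (phi k) x) + (u (phi k) x - f x)).
  by apply/funext => x; ring.
apply: le_trans (nsqD_le _ _) _; [exact: L2B..|].
have k1 := M2P k (leq_maxr _ _).
have k2 := M1P n (phi k) Mn (leq_trans (leq_maxl _ _) (phik k)).
by lra.
Qed.

(** Expanding a nonnegative square gives -2 <f, u n - f> <= t ||f||^2 + ||u n - f||^2 / t, and t is
    chosen so that both terms on the right are at most e / 2 for large n. *)
Lemma nsq_lsc u f (e : R) : (forall n, L2 mu (u n)) -> L2 mu f ->
  nsq_cvg u f -> 0 < e ->
  exists N, forall n, (N <= n)%N -> nsq f - e <= nsq (u n).
Proof.
move=> Lu Lf uf e0.
have F0 : 0 <= nsq f by exact: nsq_ge0.
pose t := e / 2 / (1 + nsq f).
have t0 : 0 < t by rewrite !divr_gt0//; lra.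
have tE : t * (1 + nsq f) = e / 2 by rewrite divfK//; lra.
have d0 : 0 < t * (e / 2) by rewrite mulr_gt0//; lra.
have [N NP] := uf _ d0; exists N => n /NP {}NP.
have Ld := L2B (Lu n) Lf.
have e1 : nsq (fun x => 1 * f x + 1 * (u n x - f x)) = nsq (u n).
  by congr Rintegral; apply/funext => x; ring.
have := nsq_ge0 mu (fun x => t * f x + 1 * (u n x - f x)).
move: e1; rewrite !nsq_lin// => e1.
set B := ip _ _ _ in e1 *; set X := nsq f in F0 tE e1 *.
set Y := nsq (fun x => _) in e1 NP * => e2.
have Y0 : 0 <= Y by exact: nsq_ge0.
have e3 : t * (- (2 * B)) <= t * (t * X + e / 2) by nra.
rewrite ler_pM2l// in e3.
by nra.
Qed.

Lemma nsq_cvg_le u f (C : R) : (forall n, L2 mu (u n)) -> L2 mu f ->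
  nsq_cvg u f -> (forall n, nsq (u n) <= C) -> nsq f <= C.
Proof.
move=> Lu Lf uf uC; apply/ler_addgt0Pr => e e0.
have [N NP] := nsq_lsc Lu Lf uf e0.
by have := NP N (leqnn N); have := uC N; lra.
Qed.

End SquareIntegrableLimits.

(** * Near-minimisers of a strongly convex functional *)

Section StronglyConvex.
Context {d : measure_display} {T : measurableType d} {R : realType}
  (mu : {measure set T -> \bar R}).
Implicit Types (p q : T -> R).

Definition mid p q : T -> R := fun x => 2^-1 * p x + 2^-1 * q x.

Lemma L2_mid p q : L2 mu p -> L2 mu q -> L2 mu (mid p q).
Proof. exact: L2_lin. Qed.

(* The infima of Phi over the decreasing sets K n increase to a finite limit,
   so by strong convexity near-minimisers are eventually close to each other. *)
Lemma near_minimizers_cauchy (K : nat -> (T -> R) -> Prop)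
    (Phi : (T -> R) -> R) (c M : R) : 0 < c ->
  (forall n m p, (n <= m)%N -> K m p -> K n p) ->
  (forall n p q, K n p -> K n q -> K n (mid p q)) ->
  (forall p q, K 0%N p -> K 0%N q -> Phi (mid p q) <=
     2^-1 * Phi p + 2^-1 * Phi q - c * nsq mu (fun x => p x - q x)) ->
  (forall p, K 0%N p -> 0 <= Phi p) ->
  (forall n, exists p, K n p /\ Phi p <= M) ->
  exists g : nat -> T -> R, [/\ forall n, K n (g n), nsq_cauchy mu g &
    forall n q, K n q -> Phi (g n) <= Phi q + n.+1%:R^-1].
Proof.
move=> c0 Kdec Kmid Phimid Phi0 Kne.
have K0 n p : K n p -> K 0%N p by exact: Kdec.
pose I n := inf [set Phi p | p in K n].
have hI n : has_inf [set Phi p | p in K n].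
  split; first by have [p [Kp _]] := Kne n; exists (Phi p), p.
  by exists 0 => _ [p /K0 Kp <-]; exact: Phi0.
have Ile n p : K n p -> I n <= Phi p.
  by move=> Kp; apply: ge_inf; [exact: (hI n).2|exists p].
have Imono n m : (n <= m)%N -> I n <= I m.
  move=> nm; apply: lb_le_inf; first exact: (hI m).1.
  by move=> _ [p Kp <-]; apply: Ile; exact: Kdec Kp.
have IM n : I n <= M.
  by have [p [Kp PM]] := Kne n; exact: le_trans (Ile _ _ Kp) PM.
have /choice[g gP] : forall n, exists p, K n p /\ Phi p < I n + n.+1%:R^-1.
  move=> n; have n0 : 0 < n.+1%:R^-1 :> R by rewrite invr_gt0 ltr0n.
  by have [_ [p Kp <-] Pp] := inf_adherent n0 (hI n); exists p.
exists g; split=> [n||n q Kq]; first exact: (gP n).1.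
  pose S := sup (range I).
  have hS : has_sup (range I).
    by split; [exists (I 0%N), 0%N|exists M => _ [n _ <-]].
  have IS n : I n <= S by apply: ub_le_sup; [exact: hS.2|exists n].
  move=> e e0.
  have ce0 : 0 < c * e by exact: mulr_gt0.
  have ce2 : 0 < c * e / 2 by lra.
  have [_ [N1 _ <-] N1P] := sup_adherent ce2 hS; rewrite -/S in N1P.
  have [N2 _ N2P] := near_infty_natSinv_lt (PosNum ce2).
  exists (maxn N1 N2).
  (* The midpoint of [g n] and [g m] lies in [K n], so c times their squared distance is at most
     half the sum of I m - I n and the two errors 1/(n+1) and 1/(m+1), each of which is at most c e
     / 2. *)
  have key n m : (maxn N1 N2 <= n)%N -> (n <= m)%N ->
      nsq mu (fun x => g n x - g m x) <= e.
    rewrite geq_max => /andP[n1 n2] nm.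
    have Kn := (gP n).1; have Km := Kdec _ _ _ nm (gP m).1.
    have h1 := Ile _ _ (Kmid _ _ _ Kn Km).
    have h2 := Phimid _ _ (K0 _ _ Kn) (K0 _ _ Km).
    have h3 := (gP n).2; have h4 := (gP m).2.
    have h5 : n.+1%:R^-1 < c * e / 2 := N2P n n2.
    have h6 : m.+1%:R^-1 < c * e / 2 := N2P m (leq_trans n2 nm).
    have h7 := IS m; have h8 := Imono _ _ n1.
    move: h3 h4 h5 h6; set a := n.+1%:R^-1; set b := m.+1%:R^-1 => h3 h4 h5 h6.
    by rewrite -(@ler_pM2l _ c)//; lra.
  move=> n m n1 m1; case: (leqP n m) => nm; first exact: key.
  by rewrite nsq_sym; apply: key => //; exact: ltnW.
by apply: ltW; apply: lt_le_trans (gP n).2 _; rewrite lerD2r; exact: Ile.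
Qed.

End StronglyConvex.

(** * Scaling, midpoints and closed sublevel sets of a convex functional *)

Section ConvexFunctional.
Context {d : measure_display} {T : measurableType d} {R : realType}
  (mu : {measure set T -> \bar R}) (E : (T -> R) -> \bar R).
Implicit Types (f g h p q : T -> R) (u : nat -> T -> R).
Context (Ege0 : nonneg_fun mu E) (Elsc : lsc_L2 mu E)
  (Econv : convex_fun mu E) (E0 : E (fun _ => 0) = 0%E).

Lemma E_scale_le f (t : R) : L2 mu f -> 0 <= t <= 1 ->
  (E (fun x => (t * f x)%R) <= t%:E * E f)%E.
Proof.
move=> Lf /andP[]; rewrite le_eqVlt => /predU1P[<- _|t0].
  by rewrite mul0e; under eq_fun do rewrite mul0r; rewrite E0.
rewrite le_eqVlt => /predU1P[->|t1].
  by rewrite mul1e; under eq_fun do rewrite mul1r.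
have := Econv Lf (L2_0 mu) (t := t); rewrite t0 t1 E0 mule0 adde0 => /(_ isT).
by under eq_fun do rewrite mulr0 addr0.
Qed.

Lemma E_scale_le_cst f (t c : R) : L2 mu f -> 0 <= t <= 1 -> (E f <= c%:E)%E ->
  (E (fun x => (t * f x)%R) <= (t * c)%:E)%E.
Proof.
move=> Lf t01 Ec; apply: le_trans (E_scale_le Lf t01) _.
by rewrite EFinM lee_wpmul2l// lee_fin; case/andP: t01.
Qed.

Lemma E_scale_mono f (s t c : R) : L2 mu f -> 0 <= s <= t ->
  (E (fun x => (t * f x)%R) <= c%:E)%E -> (E (fun x => (s * f x)%R) <= c%:E)%E.
Proof.
move=> Lf /andP[s0]; rewrite le_eqVlt => /predU1P[->//|st] H.
have t0 : 0 < t by exact: le_lt_trans st.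
have c0 : 0 <= c by rewrite -lee_fin; apply: le_trans H; apply: Ege0; exact: L2Z.
have st01 : 0 <= s / t <= 1.
  by rewrite divr_ge0 ?(ltW t0)//= ler_pdivrMr// mul1r ltW.
have := E_scale_le_cst (L2Z t Lf) st01 H.
under eq_fun do rewrite mulrA divfK ?gt_eqF//.
move=> /le_trans; apply; rewrite lee_fin.
by apply: ler_piMl => //; case/andP: st01.
Qed.

Lemma E_mid_le p q (a b : R) : L2 mu p -> L2 mu q ->
  (E p <= a%:E)%E -> (E q <= b%:E)%E ->
  (E (mid p q) <= (2^-1 * a + 2^-1 * b)%:E)%E.
Proof.
move=> Lp Lq pc qc.
have h : 0 < (2^-1 : R) < 1 by apply/andP; split; lra.
have := Econv Lp Lq h; rewrite (_ : 1 - 2^-1 = 2^-1 :> R); last by lra.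
move=> /le_trans; apply; rewrite EFinD !EFinM.
by apply: leeD; apply: lee_wpmul2l => //; rewrite lee_fin; lra.
Qed.

Lemma E_mid_le_cst p q (c : R) : L2 mu p -> L2 mu q ->
  (E p <= c%:E)%E -> (E q <= c%:E)%E -> (E (mid p q) <= c%:E)%E.
Proof.
move=> Lp Lq pc qc; have := E_mid_le Lp Lq pc qc.
by rewrite (_ : 2^-1 * c + 2^-1 * c = c)//; lra.
Qed.

Lemma E_lsc_le u f (c : R) N : (forall n, L2 mu (u n)) -> L2 mu f ->
  nsq_cvg mu u f -> (forall n, (N <= n)%N -> (E (u n) <= c%:E)%E) ->
  (E f <= c%:E)%E.
Proof.
move=> Lu Lf uf uc; apply: (le_trans (Elsc Lu Lf _)); last exact: limn_einf_le uc.
exact/nsq_cvgP.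
Qed.

(** Convexity makes the energy at most linear along the ray: 0 <= E (l f) <= l / s for 0 < l <= s,
    which tends to 0 with l. *)
Lemma E_fin_modular f (s : R) : 0 < s -> L2 mu f ->
  (E (fun x => (s * f x)%R) <= 1)%E -> modular mu E f.
Proof.
move=> s0 Lf H; split=> //.
have bd (l : R) : 0 < l <= s ->
    (0 <= E (fun x => (l * f x)%R) <= (l / s)%:E)%E.
  move=> /andP[l0 ls]; rewrite Ege0 /=; last exact: L2Z.
  have ls01 : 0 <= l / s <= 1.
    by rewrite divr_ge0 ?(ltW l0) ?(ltW s0)//= ler_pdivrMr// mul1r.
  have := E_scale_le_cst (L2Z s Lf) ls01 H.
  by under eq_fun do rewrite mulrA divfK ?gt_eqF//; rewrite mulr1.
apply: (@squeeze_cvge _ _ _ _ (cst 0%E) _ (fun l => (l / s)%:E)).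
- near=> l; apply: bd; apply/andP; split; first by [].
  by near: l; apply: nbhs_right_le.
- exact: cvg_cst.
- apply: cvg_EFin; first exact: nearW.
  rewrite -[X in _ --> X](mul0r s^-1).
  apply: cvgM; last exact: cvg_cst.
  exact: cvg_at_right_filter.
Unshelve. all: by end_near. Qed.

End ConvexFunctional.

(** * Case (A): complete modular space *)

Section BanachModular.
Context {d : measure_display} {T : measurableType d} {R : realType}
  (mu : {measure set T -> \bar R}) (E : (T -> R) -> \bar R).
Implicit Types (f g h p q s : T -> R) (u : nat -> T -> R).
Context (Ege0 : nonneg_fun mu E) (Elsc : lsc_L2 mu E)
  (Econv : convex_fun mu E) (Esym : symmetric_fun mu E)
  (E0 : E (fun _ => 0) = 0%E).

(** A Luxemburg ball without the infimum: for r > 0 and within L^2, it lies between the open and the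
    closed ball of radius r. *)
Definition lball (r : R) f := L2 mu f /\ (E (fun x => (r^-1 * f x)%R) <= 1)%E.

Lemma lball_le (r t : R) f : 0 < r -> r <= t -> lball r f -> lball t f.
Proof.
move=> r0 rt [Lf Ef]; split=> //; apply: (E_scale_mono Ege0 Econv E0) Ef => //.
have t0 : 0 < t by exact: lt_le_trans rt.
by rewrite invr_ge0 (ltW t0) lef_pV2// posrE.
Qed.

Lemma lball0 (r : R) : lball r (fun _ => 0).
Proof.
split; first exact: L2_0.
by under eq_fun do rewrite mulr0; rewrite E0.
Qed.

Lemma lballN (r : R) f : lball r f -> lball r (fun x => - f x).
Proof.
move=> [Lf Ef]; split; first exact: L2N.
by under eq_fun do rewrite mulrN; rewrite Esym//; exact: L2Z.
Qed.

(** The function (f + g) / r is the midpoint of 2 f / r and 2 g / r. *)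
Lemma lballD (r : R) f g : 0 < r -> lball (r / 2) f -> lball (r / 2) g ->
  lball r (fun x => f x + g x).
Proof.
move=> r0 [Lf Ef] [Lg Eg]; split; first exact: L2D.
have := E_mid_le_cst Econv (L2Z _ Lf) (L2Z _ Lg) Ef Eg.
by congr (E _ <= _)%E; apply/funext => x; rewrite /mid; field; rewrite gt_eqF.
Qed.

Lemma lux_lball f (e r : R) : L2 mu f -> (lux E f <= e%:E)%E -> e < r ->
  lball r f.
Proof.
move=> Lf fe er.
have /ereal_inf_lt[_ [l [l0 El] <-]] : (lux E f < r%:E)%E.
  by apply: le_lt_trans fe _; rewrite lte_fin.
by rewrite lte_fin => lr; apply: (@lball_le l) => //; exact: ltW.
Qed.

Lemma lball_lux f (r : R) : 0 < r -> lball r f -> (lux E f <= r%:E)%E.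
Proof. by move=> r0 [_ Ef]; apply: ereal_inf_lbound; exists r. Qed.

Lemma lball_modular f (r : R) : 0 < r -> lball r f -> modular mu E f.
Proof.
move=> r0 [Lf Ef]; apply: (E_fin_modular Ege0 Econv E0) Ef => //.
by rewrite invr_gt0.
Qed.

Lemma lux_ge0 f : (0 <= lux E f)%E.
Proof. by apply: le_ereal_inf_tmp => _ [l [l0 _] <-]; rewrite lee_fin ltW. Qed.

Context (EB : modular_banach mu E).

(* Balls of radii 1/(n+1) around s meeting [nsq <= N] would produce, through
   near-minimisers of the L^2 norm, an L^2 limit at Luxemburg distance 0 of s. *)
Lemma nsq_lux_lsc s (N : R) : L2 mu s -> N < nsq mu s ->
  exists2 r : R, 0 < r & forall h, lball r h -> N < nsq mu (fun x => s x + h x).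
Proof.
move=> Ls Ns; apply: contrapT => H.
pose rad n : R := n.+1%:R^-1.
have rad0 n : 0 < rad n by rewrite invr_gt0 ltr0n.
pose K n p := [/\ L2 mu p, lball (rad n) (fun x => p x - s x) & nsq mu p <= N].
have Kdec n m p : (n <= m)%N -> K m p -> K n p.
  move=> nm [Lp Bp pN]; split=> //; apply: lball_le Bp => //.
  by rewrite lef_pV2 ?posrE ?ltr0n// ler_nat ltnS.
have Kmid n p q : K n p -> K n q -> K n (mid p q).
  move=> [Lp [Lps Ep] pN] [Lq [Lqs Eq] qN].
  split; first exact: L2_mid.
    split; first by apply: L2B => //; exact: L2_mid.
    have := E_mid_le_cst Econv (L2Z _ Lps) (L2Z _ Lqs) Ep Eq.
    by congr (E _ <= _)%E; apply/funext => x; rewrite /mid; field; rewrite gt_eqF.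
  rewrite nsq_mid//; have := nsq_ge0 mu (fun x => p x - q x); lra.
have Kne n : exists p, K n p /\ nsq mu p <= N.
  apply: contrapT => Hn; apply: H; exists (rad n) => // h Bh.
  rewrite ltNge; apply/negP => hN; apply: Hn.
  exists (fun x => s x + h x); split=> //; split=> //.
    by apply: L2D => //; case: Bh.
  rewrite (_ : (fun x => _) = h)//; apply/funext => x; ring.
have [|||g [Kg gC _]] :=
  @near_minimizers_cauchy _ _ _ mu K (nsq mu) 4^-1 N _ Kdec Kmid _ _ Kne.
- lra.
- by move=> p q [Lp _ _] [Lq _ _]; rewrite nsq_mid.
- by move=> p _; exact: nsq_ge0.
have Lg n : L2 mu (g n) by case: (Kg n).
have [G [LG gG]] := nsq_complete Lg gC.
have LGs := L2B LG Ls.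
(* Each ball around s is closed in L^2 by lower semicontinuity, so the limit G lies in all of
   them. *)
have BG n : lball (rad n) (fun x => G x - s x).
  split=> //.
  apply: (E_lsc_le (u := fun k x => (rad n)^-1 * (g k x - s x)) Elsc (N := n)).
  - by move=> k; apply: L2Z; exact: L2B.
  - exact: L2Z.
  - move=> e e0.
    have a0 : 0 < (rad n)^-1 ^+ 2 by rewrite exprn_gt0// invr_gt0.
    have [M MP] := gG _ (divr_gt0 e0 a0).
    exists M => k Mk.
    rewrite (_ : (fun x => _) = (fun x => (rad n)^-1 * (g k x - G x))).
      by rewrite nsqZ; [rewrite mulrC -ler_pdivlMr//; exact: MP|exact: L2B].
    by apply/funext => x; ring.
  - by move=> k nk; have [_ [_ ]] := Kdec _ _ _ nk (Kg k).
have lux0 : lux E (fun x => G x - s x) = 0%E.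
  apply/eqP; rewrite eq_le lux_ge0 andbT; apply/lee_addgt0Pr => e e0.
  rewrite add0e; have [M _ MP] := near_infty_natSinv_lt (PosNum e0).
  apply: le_trans (lball_lux (rad0 M) (BG M)) _.
  by rewrite lee_fin ltW//; apply: MP => /=.
(* Definiteness of the Luxemburg norm identifies G with s almost everywhere, against nsq mu G <= N <
   nsq mu s. *)
have Gs := EB.1 _ (lball_modular (rad0 0%N) (BG 0%N)) lux0.
have GN : nsq mu G <= N.
  by apply: nsq_cvg_le gG _ => // n; case: (Kg n).
move: Ns; rewrite -(ae_eq_nsq LG Ls) ?ltNge ?GN//.
by apply: filterS Gs => x /eqP; rewrite subr_eq0 => /eqP.
Qed.

(** Gliding hump: were the unit ball unbounded in L^2, one could choose centres s n and shrinking
    radii r n such that the n-th stage forces a squared norm above n on a whole Luxemburg ball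
    around the new centre. The limit supplied by completeness lies in all these balls, so its
    squared norm exceeds every n. *)
Lemma nsq_bounded_unit_ball :
  exists C : R, forall f, L2 mu f -> (E f <= 1)%E -> nsq mu f <= C.
Proof.
apply: contrapT => H.
have {}H (C : R) : exists f, [/\ L2 mu f, (E f <= 1)%E & C < nsq mu f].
  apply: contrapT => HC; apply: H; exists C => f Lf Ef; rewrite leNgt.
  by apply/negP => Cf; apply: HC; exists f.
(* A state is a centre with a radius; carrying both conditions in the type lets a choice function be
   iterated. *)
pose st := {p : (T -> R) * R | L2 mu p.1 /\ 0 < p.2}.
have step (np : nat * st) : exists p' : st,
  [/\ (sval p').2 <= (sval np.2).2 / 2, (sval p').2 <= np.1.+1%:R^-1,
      lball ((sval np.2).2 / 2) (fun x => (sval p').1 x - (sval np.2).1 x) &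
      forall h, lball (2 * (sval p').2) h ->
        np.1%:R < nsq mu (fun x => (sval p').1 x + h x)].
  case: np => n [[s r] /= [Ls r0]].
  have r2 : 0 < (r / 2) ^+ 2 by rewrite exprn_gt0//; lra.
  (* The threshold gives ||(r / 2) v||^2 > 2 n + 2 ||s||^2, so s' = s + (r / 2) v, at Luxemburg
     distance at most r / 2 from s, has squared norm above n. *)
  have [v [Lv Ev Cv]] := H ((2 * n%:R + 2 * nsq mu s) / (r / 2) ^+ 2).
  pose s' x := s x + r / 2 * v x.
  have Ls' : L2 mu s' by apply: L2D => //; exact: L2Z.
  have ns' : n%:R < nsq mu s'.
    have : nsq mu (fun x => s' x + - s x) <= 2 * nsq mu s' + 2 * nsq mu s.
      apply: le_trans (nsqD_le Ls' (L2N Ls)) _.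
      have := nsqZ (-1) Ls; under eq_fun do rewrite mulN1r.
      by move=> ->; lra.
    rewrite (_ : (fun x => _) = (fun x => r / 2 * v x)); last first.
      by apply/funext => x; rewrite /s'; ring.
    by rewrite nsqZ//; rewrite ltr_pdivrMr// mulrC in Cv; lra.
  have [t t0 tP] := nsq_lux_lsc Ls' ns'.
  (* The bound t / 2 keeps the ball of radius 2 r' inside the one given by [nsq_lux_lsc], r / 2
     makes the steps summable, and 1/(n+1) sends the radii to 0. *)
  pose r' := Num.min (t / 2) (Num.min (r / 2) n.+1%:R^-1).
  have n0 : 0 < n.+1%:R^-1 :> R by rewrite invr_gt0 ltr0n.
  have r'0 : 0 < r' by rewrite !lt_min n0 andbT; apply/andP; split; lra.
  have := lexx r'; rewrite {2}/r' !le_min => /and3P[a1 a2 a3].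
  exists (exist _ (s', r') (conj Ls' r'0)); split=> //=.
    split; first exact: L2B.
    rewrite (_ : (fun x => _) = v)//; apply/funext => x; rewrite /s'; field.
    by rewrite gt_eqF.
  by move=> h Bh; apply: tP; apply: lball_le Bh; lra.
have [F FP] := choice step.
have p0P : L2 mu (fun _ : T => 0 : R) /\ (0 : R) < 1.
  by split; [exact: L2_0|exact: ltr01].
pose sq := fix sq n : st :=
  if n is m.+1 then F (m, sq m) else exist _ ((fun _ => 0), 1) p0P.
pose s n := (sval (sq n)).1; pose r n := (sval (sq n)).2.
have Ls n : L2 mu (s n) by exact: (svalP (sq n)).1.
have r0 n : 0 < r n by exact: (svalP (sq n)).2.
have rS n : r n.+1 <= r n / 2 by have [] := FP (n, sq n).
have rn n : r n.+1 <= n.+1%:R^-1 by have [] := FP (n, sq n).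
have sS n : lball (r n / 2) (fun x => s n.+1 x - s n x).
  by have [] := FP (n, sq n).
have sN n h : lball (2 * r n.+1) h -> n%:R < nsq mu (fun x => s n.+1 x + h x).
  by have [_ _ _] := FP (n, sq n); exact.
have tail k n : lball (r n) (fun x => s (n + k)%N x - s n x).
  elim: k n => [|k IH] n.
    by rewrite addn0; under eq_fun do rewrite subrr; exact: lball0.
  have := IH n.+1; rewrite addSnnS => /(lball_le (r0 _) (rS n)) B1.
  have := lballD (r0 n) (sS n) B1.
  by congr lball; apply/funext => x; ring.
have {}tail n m : (n <= m)%N -> lball (r n) (fun x => s m x - s n x).
  by move=> nm; rewrite -(subnKC nm); exact: tail.
have smod n : modular mu E (s n).
  apply: (lball_modular (r0 0%N)); have := tail 0%N n isT.
  by congr lball; apply/funext => x; rewrite subr0.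
have scauchy (e : R) : 0 < e -> exists N, forall n m, (N <= n)%N -> (N <= m)%N ->
    (lux E (fun x => (s n x - s m x)%R) <= e%:E)%E.
  move=> e0; have e2 : 0 < e / 2 by lra.
  have [M _ MP] := near_infty_natSinv_lt (PosNum e2).
  have MM : M.+1%:R^-1 < e / 2 := MP M (leqnn M).
  have rM : r M.+1 <= e / 2 := le_trans (rn M) (ltW MM).
  exists M.+1 => n m Mn Mm; apply: lball_lux => //.
  have B1 := lball_le (r0 _) rM (tail _ _ Mn).
  have B2 := lball_le (r0 _) rM (tail _ _ Mm).
  have := lballD e0 B1 (lballN B2).
  by congr lball; apply/funext => x; ring.
have [f [[Lf _] fP]] := EB.2 s smod scauchy.
have fN n : n%:R < nsq mu f.
  have r1 : 0 < r n.+1 / 2 by have := r0 n.+1; lra.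
  have [M MP] := fP _ r1.
  pose m := maxn M n.+1.
  have B1 : lball (r n.+1) (fun x => s m x - f x).
    apply: lux_lball (MP m (leq_maxl _ _)) _; first exact: L2B.
    by have := r0 n.+1; lra.
  have B2 := tail _ _ (leq_maxr M n.+1).
  have r2 : 0 < 2 * r n.+1 by have := r0 n.+1; lra.
  (* Both f and [s n.+1] are within r n.+1 of [s m]; this is why the invariant [sN] concerns the
     doubled radius. *)
  have B3 : lball (2 * r n.+1) (fun x => f x - s n.+1 x).
    have rE : 2 * r n.+1 / 2 = r n.+1 by field.
    have := @lballD (2 * r n.+1) _ _ r2; rewrite rE => /(_ _ _ B2 (lballN B1)).
    by congr lball; apply/funext => x; ring.
  have := sN _ _ B3.
  by congr (_ < nsq mu _); apply/funext => x; ring.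
have := fN (Num.trunc (nsq mu f)).+1.
by rewrite ltNge; rewrite ltW// truncnS_gt.
Qed.

(** With b = max 1 c, convexity puts f / b in the unit ball, so the bound there is multiplied by
    b^2. *)
Lemma nsq_bounded_sublevel (c : R) :
  exists C : R, forall f, L2 mu f -> (E f <= c%:E)%E -> nsq mu f <= C.
Proof.
have [C CP] := nsq_bounded_unit_ball.
pose b := Num.max 1 c.
have b1 : 1 <= b by rewrite le_max lexx.
have bc : c <= b by rewrite le_max lexx orbT.
have b0 : 0 < b by exact: lt_le_trans b1.
exists (b ^+ 2 * C) => f Lf Ef.
have bi : 0 <= b^-1 <= 1 by rewrite invr_ge0 ltW//= invf_le1.
have := E_scale_le_cst Econv E0 Lf bi (le_trans Ef _).
move=> /(_ b); rewrite lee_fin mulVf ?gt_eqF// => /(_ bc) Eb.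
have := CP _ (L2Z _ Lf) Eb; rewrite nsqZ// exprVn mulrC.
by rewrite ler_pdivrMr ?exprn_gt0// mulrC.
Qed.

(* Near-minimisers of the L^2 norm among functions lying pointwise in the
   hull of the tails of u converge both a.e. to f and in L^2. *)
Lemma banach_lsc_ae u f (c : R) : (forall n, L2 mu (u n)) ->
  measurable_fun setT f -> (forall n, (E (u n) <= c%:E)%E) -> ae_cvg mu u f ->
  L2 mu f /\ (E f <= c%:E)%E.
Proof.
move=> Lu mf uc uf; have [C CP] := nsq_bounded_sublevel c.
(* The pointwise hull is expressed by closed intervals containing all u k x with k >= n. This form
   is stable under midpoints and squeezes p x towards f x wherever u k x converges. *)
pose K n p := [/\ L2 mu p, (E p <= c%:E)%E & forall x (a b : R),
  (forall k, (n <= k)%N -> a <= u k x <= b) -> a <= p x <= b].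
have Kdec n m p : (n <= m)%N -> K m p -> K n p.
  move=> nm [Lp Ep pP]; split=> // x a b ab; apply: pP => k mk.
  by apply: ab; exact: leq_trans mk.
have Kmid n p q : K n p -> K n q -> K n (mid p q).
  move=> [Lp Ep pP] [Lq Eq qP]; split; [exact: L2_mid|exact: (E_mid_le_cst Econv)|].
  move=> x a b ab; have /andP[p1 p2] := pP _ _ _ ab.
  by have /andP[q1 q2] := qP _ _ _ ab; rewrite /mid; apply/andP; split; lra.
have Kne n : exists p, K n p /\ nsq mu p <= C.
  exists (u n); split; last exact: CP.
  by split=> // x a b; exact.
have [|||g [Kg gC _]] :=
  @near_minimizers_cauchy _ _ _ mu K (nsq mu) 4^-1 C _ Kdec Kmid _ _ Kne.
- lra.
- by move=> p q [Lp _ _] [Lq _ _]; rewrite nsq_mid.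
- by move=> p _; exact: nsq_ge0.
have Lg n : L2 mu (g n) by case: (Kg n).
have gf : ae_cvg mu g f.
  apply: filterS uf => x /cvgrPdist_le ux; apply/cvgrPdist_le => e e0.
  have [N _ NP] := ux _ e0; exists N => // n /= Nn.
  have [_ _ gP] := Kg n.
  have /andP[] : f x - e <= g n x <= f x + e.
    apply: gP => k nk; have := NP k (leq_trans Nn nk).
    by rewrite /= ler_norml => /andP[]; move=> *; apply/andP; split; lra.
  by move=> *; rewrite ler_norml; apply/andP; split; lra.
have [Lf gfn] := nsq_cauchy_ae_cvg Lg mf gC gf.
split=> //; apply: (E_lsc_le Elsc Lg Lf gfn (N := 0%N)) => n _.
by case: (Kg n).
Qed.

End BanachModular.

(** * Truncations and cutoffs as normal contractions of the line *)

Section Truncation.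
Context {R : realType}.
Implicit Types (k a b : R) (C : R -> R).

Definition truncr k a : R := Num.max (- k) (Num.min k a).

Lemma truncr_cases k a : 0 <= k ->
  [\/ a <= - k /\ truncr k a = - k, - k <= a <= k /\ truncr k a = a |
      k <= a /\ truncr k a = k].
Proof.
move=> k0; rewrite /truncr; have [ka|ak] := leP k a.
  by apply: Or33; split=> //; apply/max_idPr; lra.
have [ka|/ltW ka] := leP (- k) a.
  by apply: Or32; split; [apply/andP; split=> //; exact: ltW|].
by apply: Or31.
Qed.

Lemma contraction_truncr k : 0 <= k -> normal_contraction (truncr k).
Proof.
move=> k0; split=> [|a b].
  by have [[]|[]|[]] := truncr_cases 0 k0; move=> *; lra.
have [[]|[/andP[]]|[]] := truncr_cases a k0;
have [[]|[/andP[]]|[]] := truncr_cases b k0;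
move=> *; rewrite ler_norml; apply/andP; split;
have := ler_norm (a - b); have := ler_norm (b - a); rewrite (distrC b a); lra.
Qed.

(** This map is soft thresholding: it is 0 on [-k, k] and moves every other point by k towards 0. *)
Lemma contraction_sub_truncr k : 0 <= k ->
  normal_contraction (fun a => a - truncr k a).
Proof.
move=> k0; split=> [|a b].
  by rewrite (contraction_truncr k0).1 subr0.
have [[]|[/andP[]]|[]] := truncr_cases a k0;
have [[]|[/andP[]]|[]] := truncr_cases b k0;
move=> *; rewrite ler_norml; apply/andP; split;
have := ler_norm (a - b); have := ler_norm (b - a); rewrite (distrC b a); lra.
Qed.

Lemma contraction_comp C C' : normal_contraction C -> normal_contraction C' ->
  normal_contraction (C \o C').
Proof.
move=> [C0 CP] [C'0 C'P]; split=> [|a b] /=; first by rewrite C'0.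
exact: le_trans (CP _ _) (C'P _ _).
Qed.

Lemma contraction_norm C a : normal_contraction C -> `|C a| <= `|a|.
Proof. by move=> [C0 CP]; have := CP a 0; rewrite C0 !subr0. Qed.

Lemma normal_contraction_cvg C (v : nat -> R) a : normal_contraction C ->
  v @ \oo --> a -> (fun n => C (v n)) @ \oo --> C a.
Proof.
move=> [_ CP] /cvgrPdist_le va; apply/cvgrPdist_le => e /va.
by apply: filterS => n; apply: le_trans.
Qed.

Lemma contraction_measurable C : normal_contraction C -> measurable_fun setT C.
Proof.
move=> [_ CP]; apply: continuous_measurable_fun => a.
apply/cvgrPdist_le => e e0; near=> b.
apply: le_trans (CP a b) _; near: b.
by apply: (@cvgr_dist_le _ _ _ _ _ id).
Unshelve. all: by end_near. Qed.

Lemma truncr_norm k a : 0 <= k -> `|truncr k a| <= k.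
Proof.
move=> k0; rewrite ler_norml.
by have [[]|[/andP[]]|[]] := truncr_cases a k0; move=> *; apply/andP; split; lra.
Qed.

Lemma truncr_sqr_le k a : 0 <= k -> truncr k a ^+ 2 <= a * truncr k a.
Proof.
by move=> k0; have [[? ->]|[/andP[? ?] ->]|[? ->]] := truncr_cases a k0; nra.
Qed.

Lemma truncr_id k a : `|a| <= k -> truncr k a = a.
Proof.
rewrite ler_norml => /andP[h1 h2]; have k0 : 0 <= k by lra.
by have [[? ->]|[_ ->]|[? ->]] := truncr_cases a k0; lra.
Qed.

(* A contraction that is bounded, vanishes near 0 and tends to the identity. *)
Definition cutoff (n : nat) : R -> R :=
  truncr n.+1%:R \o (fun a => a - truncr n.+1%:R^-1 a).

Lemma contraction_cutoff n : normal_contraction (cutoff n).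
Proof.
apply: contraction_comp; first by apply: contraction_truncr; rewrite ler0n.
by apply: contraction_sub_truncr; rewrite invr_ge0 ler0n.
Qed.

Lemma cutoff_norm n a : `|cutoff n a| <= n.+1%:R.
Proof. by rewrite truncr_norm// ler0n. Qed.

(** Where the cutoff does not vanish, |a| > 1/(n+1) and hence |a| <= (n+1) a^2. Cutoffs of L^2
    functions are therefore integrable. *)
Lemma cutoff_sqr n a : `|cutoff n a| <= n.+1%:R * a ^+ 2.
Proof.
have k0 : 0 < n.+1%:R :> R by rewrite ltr0n.
rewrite /cutoff /=; set k := n.+1%:R in k0 *.
have [ak|ka] := leP `|a| k^-1.
  rewrite (truncr_id ak) subrr (contraction_truncr (ltW k0)).1 normr0.
  by rewrite mulr_ge0 ?sqr_ge0// ltW.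
apply: le_trans (contraction_norm _ (contraction_truncr (ltW k0))) _.
have ki : 0 <= k^-1 by rewrite invr_ge0 ltW.
apply: le_trans (contraction_norm a (contraction_sub_truncr ki)) _.
rewrite -(real_normK (num_real a)) expr2 mulrA.
by apply: ler_peMl => //; rewrite -ler_pdivrMl// mulr1 ltW.
Qed.

(** The cutoff of a lies between 0 and a. The bound is the majorant for the L^2 convergence of
    cutoffs. *)
Lemma cutoff_sub_norm n a : `|cutoff n a - a| <= `|a|.
Proof.
have k0 : 0 <= n.+1%:R :> R by rewrite ler0n.
have ki : 0 <= n.+1%:R^-1 :> R by rewrite invr_ge0.
rewrite /cutoff /=; set k := n.+1%:R in k0 ki *; set j := k^-1 in ki *.
have [[h1 ->]|[/andP[h1 h2] ->]|[h1 ->]] := truncr_cases a ki;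
have := truncr_cases (a - _) k0; last 1 first.
- move=> /(_ j)[[h3 ->]|[/andP[h3 h4] ->]|[h3 ->]];
  rewrite (ger0_norm (_ : 0 <= a)) ?ler_norml; try lra; apply/andP; split; lra.
- move=> /(_ (- j))[[h3 ->]|[/andP[h3 h4] ->]|[h3 ->]];
  rewrite (ler0_norm (_ : a <= 0)) ?ler_norml; try lra; apply/andP; split; lra.
- by rewrite subrr (contraction_truncr k0).1 sub0r normrN.
Qed.

Lemma cutoff_cvg a : (fun n => cutoff n a) @ \oo --> a.
Proof.
apply/cvgrPdist_le => e e0; near=> n.
have k0 : 0 <= n.+1%:R :> R by rewrite ler0n.
have ki : 0 <= n.+1%:R^-1 :> R by rewrite invr_ge0.
have an : `|a| <= n.+1%:R.
  by near: n; exists (Num.trunc `|a|).+1 => // n /= hn; apply: ltW;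
    apply: lt_le_trans (truncnS_gt _) _; rewrite ler_nat leqW.
rewrite /cutoff /= truncr_id; last first.
  exact: le_trans (contraction_norm a (contraction_sub_truncr ki)) an.
rewrite subKr; apply: le_trans (truncr_norm a ki) _.
by apply: ltW; near: n; exact: (near_infty_natSinv_lt (PosNum e0)).
Unshelve. all: by end_near. Qed.

End Truncation.

(** * Dominated convergence for real-valued integrals *)

Section DominatedConvergence.
Context {d : measure_display} {T : measurableType d} {R : realType}
  (mu : {measure set T -> \bar R}).

Lemma Rintegral_dominated_cvg (F : nat -> T -> R) (f g : T -> R) :
  (forall n, measurable_fun setT (F n)) -> measurable_fun setT f ->
  ae_cvg mu F f -> integ mu g -> (forall n x, `|F n x| <= g x) ->
  (fun n => Rintegral mu setT (F n)) @ \oo --> Rintegral mu setT f.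
Proof.
move=> mF mf Ff Ig Fg.
have [] := @dominated_convergence _ _ _ mu setT measurableT
    (fun n x => (F n x)%:E) (fun x => (f x)%:E) (fun x => (g x)%:E).
- by move=> n; exact/measurable_EFinP.
- exact/measurable_EFinP.
- apply: filterS Ff => x Fx _; apply: cvg_EFin => //; exact: nearW.
- by [].
- by apply: aeW => x n _; rewrite abse_EFin lee_fin.
move=> If _ cv; apply: fine_cvg; rewrite fineK//.
exact: integrable_fin_num If.
Qed.

End DominatedConvergence.

(** * Case (B): nonlinear Dirichlet forms and proximal points *)

Section DirichletForm.
Context {d : measure_display} {T : measurableType d} {R : realType}
  (mu : {measure set T -> \bar R}) (E : (T -> R) -> \bar R).
Implicit Types (f g h p q w : T -> R) (u : nat -> T -> R).
Context (Ege0 : nonneg_fun mu E) (Elsc : lsc_L2 mu E)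
  (Econv : convex_fun mu E).

Lemma L2_contraction C f : normal_contraction C -> L2 mu f ->
  L2 mu (fun x => C (f x)).
Proof.
move=> HC Lf; apply: (@L2_le _ _ _ _ _ f) => //.
  apply: (@measurableT_comp _ _ _ _ _ _ C); last exact: L2_meas Lf.
  exact: contraction_measurable.
by move=> x; exact: contraction_norm.
Qed.

(** The proximal point of E at f, minimising E + lam ||. - f||^2. The real value e and the real
    bounds c on competitors keep all comparisons in real arithmetic. *)
Definition prox (lam : R) f w := L2 mu w /\ exists2 e : R, E w = e%:E &
  forall q (c : R), L2 mu q -> (E q <= c%:E)%E ->
    e + lam * nsq mu (fun x => w x - f x) <= c + lam * nsq mu (fun x => q x - f x).

(** Direct method: the objective is strongly convex with constant lam / 4, so near-minimisers over
    the constant family [K] are Cauchy in L^2, and lower semicontinuity makes their limit a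
    minimiser. *)
Lemma prox_exists (lam : R) f : 0 < lam -> domE mu E f -> exists w, prox lam f w.
Proof.
move=> lam0 [Lf Ef].
pose Phi p := fine (E p) + lam * nsq mu (fun x => p x - f x).
pose K (n : nat) p := domE mu E p.
have EK p : domE mu E p -> E p = (fine (E p))%:E.
  by move=> [Lp Ep]; rewrite fineK// ge0_fin_numE// Ege0.
have Emid p q : domE mu E p -> domE mu E q ->
    (E (mid p q) <= (2^-1 * fine (E p) + 2^-1 * fine (E q))%:E)%E.
  move=> Dp Dq; apply: (E_mid_le Econv).
  - exact: Dp.1.
  - exact: Dq.1.
  - by rewrite -EK.
  - by rewrite -EK.
have Kmid n p q : K n p -> K n q -> K n (mid p q).
  move=> Dp Dq; split; first exact: L2_mid Dp.1 Dq.1.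
  exact: le_lt_trans (Emid _ _ Dp Dq) (ltry _).
have Phimid p q : K 0%N p -> K 0%N q -> Phi (mid p q) <=
    2^-1 * Phi p + 2^-1 * Phi q - lam / 4 * nsq mu (fun x => p x - q x).
  move=> Dp Dq; have := Emid _ _ Dp Dq.
  rewrite (EK _ (Kmid 0%N _ _ Dp Dq)) lee_fin.
  have := nsq_mid (L2B Dp.1 Lf) (L2B Dq.1 Lf).
  have -> : (fun x => 2^-1 * (p x - f x) + 2^-1 * (q x - f x)) =
      (fun x => mid p q x - f x) by apply/funext => x; rewrite /mid; field.
  have -> : (fun x => p x - f x - (q x - f x)) = (fun x => p x - q x).
    by apply/funext => x; ring.
  by rewrite /Phi => ->; lra.
have Phi0 p : K 0%N p -> 0 <= Phi p.
  move=> Dp; rewrite addr_ge0 ?fine_ge0 ?Ege0//; first exact: Dp.1.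
  by rewrite mulr_ge0 ?nsq_ge0// ltW.
have l40 : 0 < lam / 4 by lra.
have [//||g [Kg gC gP]] :=
  near_minimizers_cauchy (K := K) (M := Phi f) l40 _ Kmid Phimid Phi0.
  by move=> n; exists f; split.
have Lg n : L2 mu (g n) by case: (Kg n).
have [w [Lw gw]] := nsq_complete Lg gC.
have key q : domE mu E q ->
    (E w <= (Phi q - lam * nsq mu (fun x => w x - f x))%:E)%E.
  move=> Dq; apply/lee_addgt0Pr => e e0.
  (* Half of the error e pays for near-minimality, the other half for lower semicontinuity of the
     norm, which is weighted by lam. *)
  have e1 : 0 < e / (2 * lam) by rewrite divr_gt0// mulr_gt0.
  have e2 : 0 < e / 2 by lra.
  have gwf : nsq_cvg mu (fun n x => g n x - f x) (fun x => w x - f x).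
    move=> r /gw[N NP]; exists N => n /NP; apply: le_trans.
    rewrite le_eqVlt; apply/orP; left; apply/eqP.
    by congr nsq; apply/funext => x; ring.
  have [N NP] := nsq_lsc (fun n => L2B (Lg n) Lf) (L2B Lw Lf) gwf e1.
  have [M _ MP] := near_infty_natSinv_lt (PosNum e2).
  rewrite -EFinD; apply: (E_lsc_le Elsc Lg Lw gw (N := maxn N M)) => n.
  rewrite geq_max => /andP[Nn Mn].
  rewrite (EK _ (Kg n)) lee_fin.
  have h1 := gP n q Dq; have h2 := NP n Nn.
  have h3 : n.+1%:R^-1 < e / 2 := MP n Mn.
  have h4 : lam * (nsq mu (fun x => w x - f x) - e / (2 * lam)) <=
    lam * nsq mu (fun x => g n x - f x) by rewrite ler_pM2l.
  have h5 : lam * (e / (2 * lam)) = e / 2 by field; rewrite gt_eqF.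
  rewrite mulrBr h5 in h4; rewrite {1}/Phi in h1.
  by move: h1 h3; set z := n.+1%:R^-1 => h1 h3; lra.
have Dw : domE mu E w.
  by split=> //; apply: le_lt_trans (key f (conj Lf Ef)) (ltry _).
exists w; split=> //; exists (fine (E w)); first exact: EK.
move=> q c Lq Eq.
have Dq : domE mu E q by split=> //; exact: le_lt_trans Eq (ltry _).
have := key q Dq; rewrite (EK _ Dw) lee_fin /Phi.
by move: Eq; rewrite (EK _ Dq) lee_fin; lra.
Qed.

(* First-order optimality of w along the segment from w to q. *)
Lemma prox_subgradient (lam : R) f w q (c : R) : 0 < lam -> L2 mu f ->
  prox lam f w -> L2 mu q -> (E q <= c%:E)%E ->
  (E w <= (c + 2 * lam * ip mu (fun x => w x - f x) (fun x => q x - w x))%:E)%E.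
Proof.
move=> lam0 Lf [Lw [e Ew wP]] Lq Eq; rewrite Ew lee_fin.
set B := ip _ _ _; pose Q := nsq mu (fun x => q x - w x).
have Q0 : 0 <= Q by exact: nsq_ge0.
(* Minimality of w against t q + (1 - t) w, divided by t, leaves the error t lam ||q - w||^2. *)
have step (t : R) : 0 < t -> t < 1 -> e <= c + 2 * lam * B + t * (lam * Q).
  move=> t0 t1.
  have Et : (E (fun x => (t * q x + (1 - t) * w x)%R) <= (t * c + (1 - t) * e)%:E)%E.
    have := Econv Lq Lw (t := t); rewrite t0 t1 => /(_ isT) /le_trans; apply.
    rewrite Ew [leRHS]EFinD !EFinM; apply: leeD => //.
    by apply: lee_wpmul2l => //; rewrite lee_fin ltW.
  have := wP _ _ (L2_lin t (1 - t) Lq Lw) Et.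
  rewrite (_ : (fun x => t * q x + _ - f x) =
    (fun x => 1 * (w x - f x) + t * (q x - w x))); last first.
    by apply/funext => x; ring.
  rewrite nsq_lin; [|exact: L2B..].
  rewrite -/B -/Q => h.
  by rewrite -(@ler_pM2l _ t)//; lra.
apply/ler_addgt0Pr => r r0.
have l0 : 0 <= lam * Q by rewrite mulr_ge0// ltW.
(* This choice gives 0 < t < 1 and t lam Q <= r. *)
pose t := r / (1 + r + lam * Q).
have t0 : 0 < t by rewrite divr_gt0//; lra.
have tE : t * (1 + r + lam * Q) = r by rewrite divfK//; lra.
have t1 : t < 1 by rewrite ltr_pdivrMr; lra.
by have := step t t0 t1; nra.
Qed.

Context (Esym : symmetric_fun mu E) (ED : dirichlet_form mu E).

(** With base function 0, the operating inequality and symmetry read 2 E (C f) <= 2 E f. *)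
Lemma E_contraction C f : normal_contraction C -> L2 mu f ->
  (E (fun x => C (f x)) <= E f)%E.
Proof.
move=> HC Lf; have LC := L2_contraction HC Lf.
have : (E (fun x => C (f x)) + E (fun x => (- C (f x))%R) <=
    E f + E (fun x => (- f x)%R))%E.
  have := ED HC (L2_0 mu) Lf.
  by congr (E _ + E _ <= E _ + E _)%E; apply/funext => x; rewrite add0r.
rewrite (Esym LC) (Esym Lf).
have := Ege0 LC; have := Ege0 Lf.
case: (E f) (E (fun x => C (f x))) => [y| |] [z| |]//= _ _.
  by rewrite -!EFinD !lee_fin; lra.
all: by rewrite ?leey.
Qed.

(* Comparing w with w - truncr t w bounds the integral of w * truncr t w
   by 2 t times the L^1 norm of f; then t -> 0. *)
Lemma prox_integ (lam : R) f w : 0 < lam -> L2 mu f -> integ mu f ->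
  prox lam f w -> integ mu w.
Proof.
move=> lam0 Lf If [Lw [e Ew wP]].
pose I := Rintegral mu setT (fun x => `|f x|).
have INf := integN If.
have bd (t : R) : 0 < t -> ip mu w (fun x => truncr t (w x)) <= 2 * (t * I).
  move=> t0; pose S x := truncr t (w x).
  have LS : L2 mu S.
    by apply: L2_contraction => //; exact: contraction_truncr (ltW t0).
  have Eq : (E (fun x => (w x - S x)%R) <= e%:E)%E.
    by rewrite -Ew; apply: (E_contraction (contraction_sub_truncr (ltW t0))).
  have := wP _ _ (L2B Lw LS) Eq.
  rewrite (_ : (fun x => w x - S x - f x) =
    (fun x => 1 * (w x - f x) + (-1) * S x)); last by apply/funext => x; ring.
  rewrite nsq_lin//; last exact: L2B.
  have -> : ip mu (fun x => w x - f x) S = ip mu w S - ip mu f S.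
    rewrite /ip -RintegralB//; [|exact: L2_mul..].
    by congr Rintegral; apply/funext => x; ring.
  have h1 : nsq mu S <= ip mu w S.
    apply: le_Rintegral => //; [exact: L2_sqr|exact: L2_mul|].
    by move=> x _; apply: truncr_sqr_le; exact: ltW.
  have h2 : ip mu f S <= t * I.
    rewrite /I -RintegralZl//; apply: le_Rintegral => //.
    - exact: L2_mul.
    - exact: integZ.
    move=> x _; apply: le_trans (ler_norm _) _; rewrite normrM mulrC.
    by rewrite ler_wpM2r// truncr_norm// ltW.
  rewrite -/S => h3.
  (* Minimality yields 2 <w - f, S> <= ||S||^2 <= <w, S>, hence <w, S> <= 2 <f, S> <= 2 t I. *)
  have : lam * (2 * (ip mu w S - ip mu f S)) <= lam * nsq mu S by lra.
  by rewrite ler_pM2l//; lra.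
pose rad n : R := n.+1%:R^-1.
have rad0 n : 0 < rad n by rewrite invr_gt0 ltr0n.
(* For t = 1/(n+1) the factor truncr t (w x) / t is the sign of w x once t < |w x|, so h n x is
   eventually |w x|, and Fatou's lemma bounds the integral of |w| by 2 I. *)
pose h n x := n.+1%:R * (w x * truncr (rad n) (w x)).
have mw := L2_meas Lw.
have LS n : L2 mu (fun x => truncr (rad n) (w x)).
  by apply: L2_contraction => //; exact: contraction_truncr (ltW (rad0 n)).
have Ih n : integ mu (h n) by apply: integZ; exact: L2_mul.
have h0 n x : 0 <= h n x.
  rewrite mulr_ge0// (le_trans (sqr_ge0 _) (truncr_sqr_le _ _))//.
  exact: ltW (rad0 n).
have hI n : (\int[mu]_x (h n x)%:E <= (2 * I)%:E)%E.
  rewrite -(fineK (integrable_fin_num measurableT (Ih n))) lee_fin.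
  change (Rintegral mu setT (h n) <= 2 * I).
  rewrite RintegralZl//; last exact: L2_mul.
  have := bd _ (rad0 n); rewrite /ip => hb.
  rewrite -ler_pdivlMl ?ltr0n//; apply: le_trans hb _.
  by rewrite mulrCA.
apply/integrableP; split; first exact/measurable_EFinP.
apply: (@le_lt_trans _ _ (2 * I)%:E); last exact: ltry.
have -> : (\int[mu]_x `|(w x)%:E| = \int[mu]_x limn_einf (fun n => (h n x)%:E))%E.
  apply: eq_integral => x _; apply/esym.
  apply: (@cvg_limn_einf_sup _ _ _ _).1.
  apply: cvg_EFin; first exact: nearW.
  apply: cvg_near_cst.
  have [w0|w0] := eqVneq (w x) 0.
    by apply: nearW => n; rewrite /= /h w0 mul0r mulr0 normr0.
  have aw : 0 < `|w x| by rewrite normr_gt0.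
  apply: filterS (near_infty_natSinv_lt (PosNum aw)) => n /= hn.
  have k0 : n.+1%:R != 0 :> R by rewrite pnatr_eq0.
  rewrite /h; have [[h1 ->]|[/andP[h1 h2] _]|[h1 ->]] :=
    truncr_cases (w x) (ltW (rad0 n)).
  - have wn : w x <= 0 by have := rad0 n; lra.
    by rewrite ler0_norm// /rad mulrN mulrN mulrCA mulfV// mulr1.
  - by move: hn; rewrite ltNge ler_norml h1 h2.
  - have wn : 0 <= w x by have := rad0 n; lra.
    by rewrite ger0_norm// /rad mulrCA mulfV// mulr1.
apply: (le_trans (fatou mu measurableT _ _)).
- by move=> n; exact: measurable_int (Ih n).
- by move=> n x _; rewrite lee_fin.
by apply: (@limn_einf_le _ _ _ 0%N) => n _.
Qed.

(** In the subgradient inequality at q = u n, the product (w - f) (u n - w) is dominated by k |w -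
    f| + |(w - f) w|, integrable since w and f are. The pairing tends to -||w - f||^2 <= 0. *)
Lemma prox_le_of_bounded_ae_cvg (lam k c : R) f w u : 0 < lam -> L2 mu f ->
  integ mu f -> prox lam f w -> (forall n, L2 mu (u n)) ->
  (forall n x, `|u n x| <= k) -> (forall n, (E (u n) <= c%:E)%E) ->
  ae_cvg mu u f -> (E w <= c%:E)%E.
Proof.
move=> lam0 Lf If pw Lu uk uc uf.
have Iw := prox_integ lam0 Lf If pw.
have Lw := pw.1; have Lwf := L2B Lw Lf.
pose a n := ip mu (fun x => w x - f x) (fun x => u n x - w x).
have ale n : (E w <= (c + 2 * lam * a n)%:E)%E by exact: prox_subgradient.
have acv : a @ \oo --> ip mu (fun x => w x - f x) (fun x => f x - w x).
  apply: (@Rintegral_dominated_cvg _ _ _ _ _ _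
    (fun x => k * `|w x - f x| + `|(w x - f x) * w x|)).
  - by move=> n; apply: (@integ_meas _ _ _ mu); apply: L2_mul => //; exact: L2B.
  - by apply: (@integ_meas _ _ _ mu); apply: L2_mul => //; exact: L2B.
  - apply: filterS uf => x ux; apply: cvgM; first exact: cvg_cst.
    by apply: cvgB => //; exact: cvg_cst.
  - apply: integD.
      apply: integZ; apply: integN.
      have := integD Iw (integZ (-1) If).
      by congr integ; apply/funext => x; ring.
    by apply: integN; exact: L2_mul.
  - move=> n x; rewrite mulrBr; apply: le_trans (ler_normB _ _) _.
    by rewrite lerD2r normrM mulrC ler_wpM2r.
have alim : ip mu (fun x => w x - f x) (fun x => f x - w x) <= 0.
  rewrite (_ : ip _ _ _ = - nsq mu (fun x => w x - f x)) ?oppr_le0 ?nsq_ge0//.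
  rewrite -mulN1r -RintegralZl//; last exact: L2_sqr.
  by congr Rintegral; apply/funext => x; ring.
apply/lee_addgt0Pr => e e0.
have e1 : 0 < e / (2 * lam) by rewrite divr_gt0// mulr_gt0.
have /cvgrPdist_le/(_ _ e1)[N _ NP] := acv.
apply: le_trans (ale N) _; rewrite -EFinD lee_fin lerD2l.
rewrite mulrC -ler_pdivlMr ?mulr_gt0//.
by have := NP N (leqnn N); rewrite /= ler_norml => /andP[]; lra.
Qed.

(** The proximal points w n for lam = n + 1 have energy at most c. Comparison with f gives (n + 1)
    ||w n - f||^2 <= E f, so they tend to f in L^2. *)
Lemma dirichlet_lsc_bounded_ae (k c : R) f u : domE mu E f -> integ mu f ->
  (forall n, L2 mu (u n)) -> (forall n x, `|u n x| <= k) ->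
  (forall n, (E (u n) <= c%:E)%E) -> ae_cvg mu u f -> (E f <= c%:E)%E.
Proof.
move=> Df If Lu uk uc uf; have Lf := Df.1.
have n0 n : 0 < n.+1%:R :> R by rewrite ltr0n.
have /choice[w wP] : forall n : nat, exists w, prox n.+1%:R f w.
  by move=> n; exact: prox_exists.
have Lw n : L2 mu (w n) := (wP n).1.
have wc n : (E (w n) <= c%:E)%E.
  exact: (prox_le_of_bounded_ae_cvg (n0 n) Lf If (wP n) Lu uk uc uf).
apply: (E_lsc_le Elsc Lw Lf _ (N := 0%N)) => // e e0.
have EfE : E f = (fine (E f))%:E by rewrite fineK// ge0_fin_numE ?Ege0// Df.2.
have F0 : 0 <= fine (E f) by rewrite fine_ge0// Ege0.
exists (Num.trunc (fine (E f) / e)) => n Nn.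
have [_ [ew Ew wmin]] := wP n.
have ew0 : 0 <= ew by rewrite -lee_fin -Ew Ege0.
have := wmin f (fine (E f)) Lf; rewrite -EfE => /(_ (lexx _)).
rewrite (_ : nsq mu (fun x => f x - f x) = 0); last first.
  rewrite (_ : (fun x => f x - f x) = (fun x => 0 * f x)).
    by rewrite nsqZ// expr0n mul0r.
  by apply/funext => x; rewrite subrr mul0r.
rewrite mulr0 addr0 => h1.
have h2 : fine (E f) <= n.+1%:R * e.
  rewrite -ler_pdivrMr//; apply: ltW; apply: lt_le_trans (truncnS_gt _) _.
  by rewrite ler_nat ltnS.
by rewrite -(@ler_pM2l _ n.+1%:R)//; lra.
Qed.

(** For fixed m, the m-th cutoffs of u n are bounded, do not raise the energy and converge to the
    cutoff of f, which is integrable. As m grows, the cutoffs of f tend to f in L^2. *)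
Lemma dirichlet_lsc_ae (c : R) f u : domE mu E f -> (forall n, L2 mu (u n)) ->
  (forall n, (E (u n) <= c%:E)%E) -> ae_cvg mu u f -> (E f <= c%:E)%E.
Proof.
move=> Df Lu uc uf; have Lf := Df.1.
have LC g m : L2 mu g -> L2 mu (fun x => cutoff m (g x)).
  by move=> Lg; apply: L2_contraction => //; exact: contraction_cutoff.
have EC m : (E (fun x => cutoff m (f x)) <= c%:E)%E.
  apply: (@dirichlet_lsc_bounded_ae m.+1%:R c _ (fun n x => cutoff m (u n x))).
  - split; first exact: LC.
    apply: le_lt_trans Df.2; apply: E_contraction => //.
    exact: contraction_cutoff.
  - apply: (@integ_le _ _ _ _ _ (fun x => m.+1%:R * f x ^+ 2)).
    + exact: L2_meas (LC f m Lf).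
    + by move=> x; exact: cutoff_sqr.
    + by apply: integZ; exact: L2_sqr.
  - by move=> n; exact: LC.
  - by move=> n x; exact: cutoff_norm.
  - move=> n; apply: le_trans (uc n).
    by apply: E_contraction => //; exact: contraction_cutoff.
  - apply: filterS uf => x ux.
    by apply: (@normal_contraction_cvg _ (cutoff m)) ux; exact: contraction_cutoff.
apply: (@E_lsc_le _ _ _ _ _ Elsc (fun m x => cutoff m (f x)) _ _ 0%N) => //.
  by move=> m; exact: LC.
have cv : (fun n => nsq mu (fun x => cutoff n (f x) - f x)) @ \oo -->
    Rintegral mu setT (fun _ : T => 0 : R).
  apply: (@Rintegral_dominated_cvg _ _ _ _ _ _ (fun x => f x ^+ 2)).
  - move=> n; apply: (@integ_meas _ _ _ mu); apply: L2_sqr.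
    by apply: L2B => //; exact: LC.
  - exact: measurable_cst.
  - apply: aeW => x; rewrite -[X in _ --> X](expr0n _ 2).
    under eq_fun do rewrite expr2; rewrite expr2.
    have h : (fun n => cutoff n (f x) - f x) @ \oo --> (0 : R).
      rewrite -(subrr (f x)); apply: cvgB; [exact: cutoff_cvg|exact: cvg_cst].
    exact: cvgM.
  - exact: L2_sqr.
  - move=> n x; rewrite normrX -[leRHS]real_normK ?num_real//.
    by rewrite lerXn2r ?nnegrE// cutoff_sub_norm.
move=> e e0; have /cvgrPdist_le/(_ _ e0)[N _ NP] := cv.
exists N => n Nn; have := NP n Nn.
rewrite /= (_ : Rintegral mu setT (fun=> 0) = 0); last first.
  by rewrite /Rintegral integral0.
by rewrite sub0r normrN ger0_norm// nsq_ge0.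
Qed.

End DirichletForm.

(** * Relaxation of a functional and the final assembly *)

Section Relaxation.
Context {d : measure_display} {T : measurableType d} {R : realType}
  (mu : {measure set T -> \bar R}).

(** A lower semicontinuous G is one of its own lower semicontinuous minorants, hence the largest. *)
Lemma relaxation_lsc (G : (T -> R) -> \bar R) f : lsc_L0 mu G -> L0 f ->
  relaxation mu G f = G f.
Proof.
move=> Glsc mf; apply/eqP; rewrite eq_le; apply/andP; split.
  by apply: ge_ereal_sup => _ [H [_ HG] <-]; exact: HG.
by apply: ereal_sup_ubound; exists G.
Qed.

End Relaxation.

Theorem theorem3p6 (d : measure_display) (T : measurableType d) (R : realType)
  (mu : {measure set T -> \bar R}) (E : (T -> R) -> \bar R) :
  sigma_finite setT mu ->
  respects_ae mu E -> nonneg_fun mu E -> lsc_L2 mu E -> convex_fun mu E ->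
  symmetric_fun mu E -> E (fun _ => 0) = 0%E ->
  (modular_banach mu E \/ dirichlet_form mu E) ->
  Ee_exists mu E /\
  (modular_banach mu E ->
     forall f, L0 f -> Eext mu E f = relaxation mu (Eext mu E) f).
Proof.
move=> _ _ Ege0 Elsc Econv Esym E0 EAB; split=> [u f Du Df uf|EB f mf].
  apply: le_limn_einf => c phi phiI uc.
  have [psi [psiI uphif]] := uf phi phiI.
  have Lu n : L2 mu (u (phi (psi n))) := (Du _).1.
  case: EAB => [EB|ED].
    by have [] := banach_lsc_ae Ege0 Elsc Econv Esym E0 EB Lu Df.1.1
      (fun n => uc (psi n)) uphif.
  exact: (dirichlet_lsc_ae Ege0 Elsc Econv Esym ED Df Lu
    (fun n => uc (psi n)) uphif).
(* It remains to prove lower semicontinuity on all of L^0. Under (A) this holds because a limit of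
   functions of bounded energy is automatically in L^2. *)
rewrite relaxation_lsc// => {f mf} u f mu_ mf uf.
apply: le_limn_einf => c phi phiI uc.
have [psi [psiI uphif]] := uf phi phiI.
(* A finite bound on [Eext] forces square integrability, its value being infinite elsewhere. *)
have uL n : L2 mu (u (phi n)) /\ (E (u (phi n)) <= c%:E)%E.
  by have := uc n; rewrite /Eext; case: asboolP => // Lu Eu; split.
have [Lf Ef] := banach_lsc_ae Ege0 Elsc Econv Esym E0 EB
  (fun n => (uL (psi n)).1) mf (fun n => (uL (psi n)).2) uphif.
by rewrite /Eext asboolT.
Qed.
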